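(* There exist $2^{\aleph_0}$ finitely generated, pairwise non-quasi-isometric, (pairwise) elementarily equivalent groups.
   Context: Two groups are elementarily equivalent if they satisfy the same first-order sentences in the language of groups. Finitely generated groups are considered as metric spaces with word metrics with respect to finite generating sets, and quasi-isometry is the usual quasi-isometry of metric spaces. *)

(* Defs.v *)
From HB Require Import structures.
From mathcomp Require Import all_boot all_order all_algebra.
From mathcomp Require Import boolp classical_sets reals topology.

Set Implicit Arguments.
Unset Strict Implicit.
Unset Printing Implicit Defensive.

Import Order.TTheory GRing.Theory Num.Theory.

(* First-order language of groups, well-scoped: [gformula n] is the type of
   formulas whose free variables are among the [n] variables of ['I_n]; a
   quantifier binds the variable [ord0] of its body, the variables of the
   context being shifted by [lift ord0]. *)

Inductive gterm (n : nat) : Type :=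
| GVar of 'I_n
| GOne
| GMul of gterm n & gterm n
| GInv of gterm n.

Arguments GOne {n}.

Inductive gformula : nat -> Type :=
| GEq n of gterm n & gterm n : gformula n
| GFalse n : gformula n
| GNot n of gformula n : gformula n
| GAnd n of gformula n & gformula n : gformula n
| GOr n of gformula n & gformula n : gformula n
| GImplies n of gformula n & gformula n : gformula n
| GForall n of gformula n.+1 : gformula n
| GExists n of gformula n.+1 : gformula n.

Definition gsentence : Type := gformula 0.

Fixpoint gterm_eval (G : groupType) n (e : 'I_n -> G) (t : gterm n) : G :=
  match t with
  | GVar i => e i
  | GOne => 1%g
  | GMul t1 t2 => (gterm_eval e t1 * gterm_eval e t2)%g
  | GInv t1 => ((gterm_eval e t1)^-1)%g
  end.

Definition env_cons (T : Type) n (x : T) (e : 'I_n -> T) : 'I_n.+1 -> T :=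
  fun i => if unlift ord0 i is Some j then e j else x.

Definition env_nil (T : Type) : 'I_0 -> T :=
  fun i => match notF (ltn_ord i) with end.

Fixpoint gholds (G : groupType) n (phi : gformula n) : ('I_n -> G) -> Prop :=
  match phi in gformula n return ('I_n -> G) -> Prop with
  | GEq _ t u => fun e => gterm_eval e t = gterm_eval e u
  | GFalse _ => fun=> False
  | GNot _ p => fun e => ~ gholds p e
  | GAnd _ p q => fun e => gholds p e /\ gholds q e
  | GOr _ p q => fun e => gholds p e \/ gholds q e
  | GImplies _ p q => fun e => gholds p e -> gholds q e
  | GForall _ p => fun e => forall x : G, gholds p (env_cons x e)
  | GExists _ p => fun e => exists x : G, gholds p (env_cons x e)
  end.

Definition satisfies (G : groupType) (phi : gsentence) : Prop :=
  gholds phi (@env_nil G).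

Definition elementarily_equivalent (G H : groupType) : Prop :=
  forall phi : gsentence, satisfies G phi <-> satisfies H phi.

Definition is_word (G : groupType) (S : seq G) (w : seq G) : bool :=
  all (fun s => (s \in S) || (s^-1%g \in S)) w.

Definition generates (G : groupType) (S : seq G) : Prop :=
  forall g : G, exists2 w : seq G, is_word S w & (\prod_(s <- w) s)%g = g.

Definition finitely_generated (G : groupType) : Prop :=
  exists S : seq G, generates S.

Record genset (G : groupType) : Type := GenSet {
  gens :> seq G;
  gensP : generates gens
}.

Section WordMetric.
Variables (G : groupType) (S : genset G).
Implicit Types x y z g : G.

Definition spelled_in (g : G) (n : nat) : bool :=
  `[< exists w : seq G,
        [/\ is_word S w, size w = n & (\prod_(s <- w) s)%g = g] >].

Lemma spelled_in_ex g : exists n, spelled_in g n.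
Proof. by have [w wS wg] := gensP S g; exists (size w); apply/asboolP; exists w. Qed.

Definition word_length (g : G) : nat := ex_minn (spelled_in_ex g).

Lemma word_length_spelled g : exists w : seq G,
  [/\ is_word S w, size w = word_length g & (\prod_(s <- w) s)%g = g].
Proof. by rewrite /word_length; case: ex_minnP => n /asboolP. Qed.

Lemma word_length_le (w : seq G) :
  is_word S w -> (word_length (\prod_(s <- w) s)%g <= size w)%N.
Proof.
move=> wS; rewrite /word_length; case: ex_minnP => n _; apply.
by apply/asboolP; exists w.
Qed.

Lemma word_length1 : word_length 1%g = 0%N.
Proof.
have := @word_length_le [::] isT.
by rewrite big_nil leqn0 => /eqP.
Qed.

Lemma word_length_eq0 g : word_length g = 0%N -> g = 1%g.
Proof.
have [w [_ <- <-]] := word_length_spelled g.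
by move/size0nil => ->; rewrite big_nil.
Qed.

Lemma word_lengthM g h :
  (word_length (g * h)%g <= word_length g + word_length h)%N.
Proof.
have [u [uS <- ug]] := word_length_spelled g.
have [v [vS <- vh]] := word_length_spelled h.
rewrite -{1}ug -{1}vh -big_cat -size_cat; apply: word_length_le.
by rewrite /is_word all_cat; apply/andP.
Qed.

Lemma prod_inv_rev (w : seq G) :
  (\prod_(s <- rev [seq x^-1%g | x <- w]) s)%g = ((\prod_(s <- w) s)^-1)%g.
Proof.
elim: w => [|a w IHw]; first by rewrite !big_nil invg1.
by rewrite /= rev_cons -cats1 big_cat /= IHw big_seq1 big_cons invgM.
Qed.

Lemma word_lengthV_le g : (word_length g^-1%g <= word_length g)%N.
Proof.
have [w [wS <- <-]] := word_length_spelled g.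
rewrite -prod_inv_rev -(size_map (fun x => x^-1%g) w) -size_rev; apply: word_length_le.
rewrite /is_word all_rev all_map; apply: sub_all wS => s /=.
by rewrite invgK orbC.
Qed.

Lemma word_lengthV g : word_length g^-1%g = word_length g.
Proof.
apply/eqP; rewrite eqn_leq word_lengthV_le /=.
by rewrite -{1}(invgK g) word_lengthV_le.
Qed.

End WordMetric.

(* [G] as a metric space, with the (left-invariant) word metric of [S]. *)
Definition word_space (R : realType) (G : groupType) (S : genset G) : Type := G.

Section WordSpace.
Local Open Scope ring_scope.
Variables (R : realType) (G : groupType) (S : genset G).

HB.instance Definition _ := Choice.on (word_space R S).

Definition word_dist (x y : word_space R S) : R :=
  (word_length S ((x : G)^-1 * (y : G))%g)%:R.

Fact word_distxx x : word_dist x x = 0.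
Proof. by rewrite /word_dist mulVg word_length1. Qed.

Fact word_dist_positivity x y : word_dist x y = 0 -> x = y.
Proof.
move/eqP; rewrite /word_dist pnatr_eq0 => /eqP /word_length_eq0 xy1.
by rewrite -[RHS](mulVKg (x : G)) xy1 mulg1.
Qed.

Fact word_dist_sym x y : word_dist x y = word_dist y x.
Proof. by rewrite /word_dist -word_lengthV invgM invgK. Qed.

Fact word_dist_triangle y x z :
  word_dist x z <= word_dist x y + word_dist y z.
Proof.
rewrite /word_dist -natrD ler_nat.
have -> : ((x : G)^-1 * z = (x : G)^-1 * y * ((y : G)^-1 * z))%g.
  by rewrite mulgA mulgK.
exact: word_lengthM.
Qed.

HB.instance Definition _ := @isMetric.Build R (word_space R S)
  word_dist word_distxx word_dist_positivity word_dist_sym word_dist_triangle.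

End WordSpace.

Section QuasiIsometry.
Local Open Scope ring_scope.

Definition quasi_isometry (R : realType) (X Y : metricType R) (f : X -> Y) :
    Prop :=
  exists L C : R, [/\ 1 <= L, 0 <= C,
    forall x x' : X,
      L^-1 * mdist x x' - C <= mdist (f x) (f x') <= L * mdist x x' + C &
    forall y : Y, exists x : X, mdist (f x) y <= C].

Definition quasi_isometric (R : realType) (X Y : metricType R) : Prop :=
  exists f : X -> Y, quasi_isometry f.

(* The word metrics of any two finite generating sets of a group are
   bi-Lipschitz equivalent, so the choice of [S] and [T] is immaterial. *)
Definition quasi_isometric_groups (R : realType) (G H : groupType) : Prop :=
  exists (S : genset G) (T : genset H),
    quasi_isometric (word_space R S) (word_space R T).

End QuasiIsometry.

(* Main.v *)
Require Import Defs.
From mathcomp Require Import all_boot all_order all_algebra.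
From mathcomp Require Import boolp classical_sets reals topology.
From HB Require Import structures.
From mathcomp Require Import generic_quotient zify.

(* For a set A of integers let
     G_A = < a, b, t | [a, t^i b t^-i] = 1 for i in A >.
   The ball of radius n in G_A depends only on A on [-2n, 2n], the i-th
   relator holds in G_A only if i is in A, and translating A does not change the
   isomorphism type of G_A.

   Elementary equivalence: the set of A such that G_A satisfies a given
   first-order sentence has the property of Baire in the Cantor space of all A;
   as the translations act on it topologically transitively, this set is meager
   or comeager.  Hence there are countably many dense open sets such that all
   groups G_A, with A in their intersection, have the same theory.

   Quasi-isometry: if A has no element of absolute value in ]r, R], all
   relations of G_A of length linear in R follow from those of length linear
   in r.  If i in B lies well inside the gap, the loop of the i-th relator in G_B
   is not filled by much shorter loops, so G_A and G_B cannot be quasi-isometric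
   with constants small compared to r, i / r and R / i.  We build, for all x in
   2^nat, generic sets A_x with common windows and with at most one element in
   the n-th gap, present or absent according to x. *)

Set Implicit Arguments.
Unset Strict Implicit.
Unset Printing Implicit Defensive.

Import Order.TTheory GRing.Theory Num.Theory.

(** * The groups G_A *)

(* [None], [Some false], [Some true] stand for the generators t, a, b, and the
   boolean is [true] for a generator and [false] for its inverse. *)
Definition letter : Type := (option bool * bool)%type.
Definition word : Type := seq letter.

Definition gen_t (e : bool) : letter := (None, e).
Definition gen_a (e : bool) : letter := (Some false, e).
Definition gen_b (e : bool) : letter := (Some true, e).
Definition linv (l : letter) : letter := (l.1, ~~ l.2).
Definition winv (u : word) : word := rev (map linv u).

Definition tpow (j : int) : word := nseq `|j| (gen_t (0 <= j)%R).

Definition relator (i : int) : word :=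
  gen_a true :: tpow i ++ gen_b true :: tpow (- i)%R ++
  gen_a false :: tpow i ++ gen_b false :: tpow (- i)%R.

Section Actions.
Variables (Y : Type) (step : letter -> Y -> Y).

Definition run (y : Y) (u : word) : Y := foldl (fun y l => step l y) y u.

Definition inverse_steps : Prop := forall l y, step (linv l) (step l y) = y.

Lemma run_cat y u v : run y (u ++ v) = run (run y u) v.
Proof. exact: foldl_cat. Qed.

Lemma run_cons y l u : run y (l :: u) = run (step l y) u.
Proof. by []. Qed.

Lemma linvK : involutive linv.
Proof. by move=> [x e]; rewrite /linv /= negbK. Qed.

Lemma run_winv (stepV : inverse_steps) y u : run (run y u) (winv u) = y.
Proof.
elim: u y => //= l u IHu y.
by rewrite /winv /= rev_cons -cats1 run_cat IHu /= stepV.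
Qed.

Lemma winvK : involutive winv.
Proof. by move=> u; rewrite /winv map_rev revK mapK //; exact: linvK. Qed.

Lemma run_tpow_path (phi : int -> Y) :
  (forall k, step (gen_t true) (phi k) = phi (k + 1)%R) ->
  (forall k, step (gen_t false) (phi k) = phi (k - 1)%R) ->
  forall k j, run (phi k) (tpow j) = phi (k + j)%R.
Proof.
move=> up down k j; rewrite /tpow; case: (leP 0%R j) => j0.
  have: (k + j = k + (`|j|%N : int))%R by lia.
  move=> ->; elim: `|j|%N k => [|n IHn] k /=; first by rewrite addr0.
  by rewrite up IHn; congr phi; lia.
have: (k + j = k - (`|j|%N : int))%R by lia.
move=> ->; elim: `|j|%N k => [|n IHn] k /=; first by rewrite subr0.
by rewrite down IHn; congr phi; lia.
Qed.

Lemma run_tpowD (stepV : inverse_steps) y i j :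
  run y (tpow (i + j)%R) = run (run y (tpow i)) (tpow j).
Proof.
have nseq_rcons n (l : letter) : nseq n.+1 l = rcons (nseq n l) l.
  by elim: n => //= n {1}->.
have tpowS (n : nat) : tpow n.+1 = tpow n ++ [:: gen_t true].
  by rewrite cats1 -nseq_rcons.
have tpowN (n : nat) : tpow (- n.+1%:Z)%R = tpow (- n%:Z)%R ++ [:: gen_t false].
  case: n => [|n]; first by []; rewrite cats1 /tpow !abszN !absz_nat !oppr_ge0 -nseq_rcons.
  by [].
symmetry; apply: (run_tpow_path (phi := fun k => run y (tpow k))) => k.
  case: k => [n|n].
    by rewrite -PoszD addn1 tpowS run_cat.
  by rewrite NegzE tpowN run_cat -addn1 PoszD opprD addrNK -[RHS](stepV (gen_t false)).
case: k => [[|n]|n].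
- by rewrite sub0r (tpowN 0) run_cat.
- by rewrite -[n.+1]addn1 PoszD addrK -PoszD addn1 tpowS run_cat -[RHS](stepV (gen_t true)).
- by rewrite NegzE -opprD -PoszD addn1 (tpowN n.+1) run_cat.
Qed.

Definition is_action (A : int -> bool) : Prop :=
  inverse_steps /\ forall i, A i -> forall y, run y (relator i) = y.

End Actions.

Lemma size_tpow j : size (tpow j) = `|j|.
Proof. by rewrite size_nseq. Qed.

Lemma size_relator i : size (relator i) = 4 * `|i| + 4.
Proof. by rewrite /relator /= !size_cat /= !size_cat /= !size_cat /= !size_tpow; lia. Qed.

(* Equality in G_A is stated as equality in every action of the free group in
   which the relators act trivially, rather than via derivations, so that all
   arguments reduce to exhibiting an action. *)
Definition eqw (A : int -> bool) (u v : word) : Prop :=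
  forall (Y : Type) (step : letter -> Y -> Y), is_action step A ->
  forall y, run step y u = run step y v.

(** * The quotient group of words *)

Section EqW.
Variable A : int -> bool.

Lemma eqw_sym u v : eqw A u v -> eqw A v u.
Proof. by move=> uv Y step act y; rewrite uv. Qed.

Lemma eqw_trans u v w : eqw A u v -> eqw A v w -> eqw A u w.
Proof. by move=> uv vw Y step act y; rewrite uv // vw. Qed.

Lemma eqw_cat u u' v v' : eqw A u u' -> eqw A v v' -> eqw A (u ++ v) (u' ++ v').
Proof. by move=> uu' vv' Y step act y; rewrite !run_cat uu' // vv'. Qed.

Lemma eqw_catV u : eqw A (u ++ winv u) [::].
Proof. by move=> Y step [stepV _] y; rewrite run_cat run_winv. Qed.

Lemma eqw_Vcat u : eqw A (winv u ++ u) [::].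
Proof. by have := eqw_catV (winv u); rewrite winvK. Qed.

Lemma eqw_winv u v : eqw A u v -> eqw A (winv u) (winv v).
Proof.
move=> uv Y step act y; have [stepV _] := act.
rewrite -[in LHS](run_winv stepV y (winv v)) winvK -(uv _ _ act).
by rewrite (run_winv stepV).
Qed.

Lemma eqw_relator i : A i -> eqw A (relator i) [::].
Proof. by move=> Ai Y step [_ act] y; rewrite act. Qed.

Arguments eqw_sym {u v}.
Arguments eqw_trans {u v w}.

Definition eqwb (u v : word) : bool := `[< eqw A u v >].

Lemma eqwb_refl : reflexive eqwb. Proof. by move=> u; apply/asboolP => Y. Qed.
Lemma eqwb_sym : symmetric eqwb.
Proof. by move=> u v; apply/asboolP/asboolP; exact: eqw_sym. Qed.
Lemma eqwb_trans : transitive eqwb.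
Proof. by move=> u v w /asboolP vu /asboolP uw; apply/asboolP/(eqw_trans vu uw). Qed.

Canonical eqw_equiv := EquivRel eqwb eqwb_refl eqwb_sym eqwb_trans.

Definition Gr : Type := {eq_quot eqw_equiv}%qT.
HB.instance Definition _ := Choice.on Gr.

Definition cls (u : word) : Gr := (\pi_({eq_quot eqw_equiv}) u)%qT.
Definition wrepr (g : Gr) : word := repr (g : {eq_quot eqw_equiv}%qT).

Lemma cls_repr g : cls (wrepr g) = g.
Proof. exact: reprK. Qed.

Lemma clsP u v : cls u = cls v <-> eqw A u v.
Proof.
split=> [/eqquotP /asboolP //|uv]; by apply/eqquotP/asboolP.
Qed.

Lemma repr_cls u : eqw A (wrepr (cls u)) u.
Proof. by apply/clsP; rewrite cls_repr. Qed.

Let one := cls [::].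
Let inv g := cls (winv (wrepr g)).
Let mul g h := cls (wrepr g ++ wrepr h).

Let mulE u v : mul (cls u) (cls v) = cls (u ++ v).
Proof. by apply/clsP/eqw_cat; exact: repr_cls. Qed.
Let invE u : inv (cls u) = cls (winv u).
Proof. by apply/clsP/eqw_winv; exact: repr_cls. Qed.

Let mulA : associative mul.
Proof.
by move=> x y z; rewrite -(cls_repr x) -(cls_repr y) -(cls_repr z) !mulE catA.
Qed.
Let mul1 : left_id one mul.
Proof. by move=> x; rewrite -(cls_repr x) mulE. Qed.
Let mulr1 : right_id one mul.
Proof. by move=> x; rewrite -(cls_repr x) mulE cats0. Qed.
Let mulV : left_inverse one inv mul.
Proof. by move=> x; rewrite -(cls_repr x) invE mulE; apply/clsP/eqw_Vcat. Qed.
Let mulrV : right_inverse one inv mul.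
Proof. by move=> x; rewrite -(cls_repr x) invE mulE; apply/clsP/eqw_catV. Qed.

HB.instance Definition _ := isGroup.Build Gr mulA mul1 mulr1 mulV mulrV.

Lemma cls1 : cls [::] = 1%g. Proof. by []. Qed.
Lemma clsM u v : cls (u ++ v) = (cls u * cls v)%g.
Proof. by rewrite -mulE. Qed.
Lemma clsV u : cls (winv u) = (cls u)^-1%g.
Proof. by rewrite -invE. Qed.
Lemma cls_cons l u : cls (l :: u) = (cls [:: l] * cls u)%g.
Proof. by rewrite -clsM. Qed.
Lemma cls_linv l : cls [:: linv l] = (cls [:: l])^-1%g.
Proof. by rewrite -clsV. Qed.

Lemma cls_tpowD i j : cls (tpow (i + j)%R) = (cls (tpow i) * cls (tpow j))%g.
Proof.
by rewrite -clsM; apply/clsP => Y step [stepV _] y; rewrite run_cat run_tpowD.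
Qed.

Lemma cls_tpowN i : cls (tpow (- i)%R) = (cls (tpow i))^-1%g.
Proof.
apply: (mulgI (cls (tpow i))).
by rewrite -cls_tpowD subrr mulgV.
Qed.

Lemma cls_gen_a_false : cls [:: gen_a false] = (cls [:: gen_a true])^-1%g.
Proof. exact: (cls_linv (gen_a true)). Qed.
Lemma cls_gen_b_false : cls [:: gen_b false] = (cls [:: gen_b true])^-1%g.
Proof. exact: (cls_linv (gen_b true)). Qed.

Lemma cls_relatorE i :
  cls (relator i) = (cls [:: gen_a true] * (cls (tpow i) * cls [:: gen_b true] * (cls (tpow i))^-1)
   * (cls [:: gen_a true])^-1 * (cls (tpow i) * (cls [:: gen_b true])^-1 * (cls (tpow i))^-1))%g.
Proof.
rewrite /relator (cls_cons (gen_a true)) clsM (cls_cons (gen_b true)) clsM (cls_cons (gen_a false)).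
rewrite clsM (cls_cons (gen_b false)).
by rewrite cls_tpowN cls_gen_a_false cls_gen_b_false !mulgA.
Qed.

Lemma cls_relator i : A i -> cls (relator i) = 1%g.
Proof. by move=> Ai; apply/clsP/eqw_relator. Qed.

End EqW.

Arguments eqw_sym {A u v}.
Arguments eqw_trans {A u v w}.

(* The identity homomorphism on words of length at most [n] factors through
   the retraction killing all conjugates of [a], [b] by [t^k], [|k| > n]. *)
Section Locality.
Variables (A A' : int -> bool) (n : nat).
Hypothesis AA' : forall i : int, `|i| <= 2 * n -> A i -> A' i.

Let kill (k : int) (g : Gr A') : Gr A' := if `|k| <= n then g else 1%g.
(** A state [(k, g)] stands for [g t^k]: a letter [a] or [b] read at height [k] contributes its
    conjugate by [t^k], unless killed. *)
Let step (l : letter) (y : int * Gr A') : int * Gr A' :=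
  let: (k, g) := y in
  match l with
  | (None, true) => (k + 1, g)%R
  | (None, false) => (k - 1, g)%R
  | (Some x, e) =>
    (k, g * kill k (cls A' (tpow k) * cls A' [:: l] * (cls A' (tpow k))^-1))%g
  end.

Let stepV : inverse_steps step.
Proof.
move=> [[x|] []] [k g] //=; last 2 first.
- by rewrite addrK.
- by rewrite subrK.
- congr (_, _); rewrite (cls_linv A' (Some x, true)) -mulgA /kill.
  by case: leqP; rewrite ?mulg1 // -!mulgA mulKg mulVKg mulgV mulg1.
- congr (_, _); rewrite (cls_linv A' (Some x, false)) -mulgA /kill.
  by case: leqP; rewrite ?mulg1 // -!mulgA mulKg mulVKg mulgV mulg1.
Qed.

Let run_tpow k g j : run step (k, g) (tpow j) = (k + j, g)%R.
Proof. exact: (run_tpow_path (phi := fun k => (k, g))). Qed.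

Let step_ok : is_action step A.
Proof.
split=> // i Ai [k g].
rewrite /relator run_cons run_cat run_tpow run_cons run_cat run_tpow.
rewrite run_cons run_cat run_tpow run_cons run_tpow !addrK.
congr (_, _); rewrite -!mulgA /kill.
(* The relator reads [a] at height [k] and [b] at height [k + i]. If both survive then
   [|i| <= 2 * n] and [AA'] applies; otherwise the commutator collapses. *)
case: leqP => kn; case: leqP => kin; rewrite ?mul1g ?mulg1 //.
- have A'i : A' i by apply: AA' => //; lia.
  have := cls_relator A'i; rewrite cls_relatorE cls_tpowD cls_gen_a_false cls_gen_b_false.
  set T := cls A' (tpow k); set U := cls A' (tpow i).
  set a := cls A' [:: gen_a true]; set b := cls A' [:: gen_b true] => rel.
  rewrite -[RHS]mulg1 invgM; congr (_ * _)%g.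
  rewrite -(mulgV T) -[in RHS](mul1g T^-1%g) -rel.
  by rewrite -!mulgA !mulKg.
- by rewrite cls_gen_a_false -!mulgA mulKg mulVKg mulgV mulg1.
- by rewrite cls_gen_b_false -!mulgA mulKg mulVKg mulgV mulg1.
Qed.

Lemma eqw_local u : size u <= n -> eqw A u [::] -> eqw A' u [::].
Proof.
move=> un uA; apply/clsP; rewrite cls1.
(* The bound keeps all heights met while reading [v] in [[-n, n]], so no letter is killed. *)
have key v k g : `|k| + size v <= n -> exists h : int,
    run step (k, g) v = (h, g * cls A' (tpow k) * cls A' v * (cls A' (tpow h))^-1)%g.
  elim: v k g => [|[[x|] e] v IHv] k g /= kv.
  - by exists k; rewrite cls1 mulg1 mulgK.
  - have [|h ->] := IHv k (g * kill k (cls A' (tpow k) * cls A' [:: (Some x, e)] *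
       (cls A' (tpow k))^-1))%g; first by lia.
    exists h; congr (_, _); rewrite /kill; have -> : `|k| <= n by lia.
    by rewrite (cls_cons _ _ v) -!mulgA mulKg.
  case: e kv => kv.
  + have [|h ->] := IHv (k + 1)%R g; first by lia.
    exists h; congr (_, _); rewrite (cls_cons _ _ v) cls_tpowD.
    by rewrite -!mulgA.
  + have [|h ->] := IHv (k - 1)%R g; first by lia.
    exists h; congr (_, _); rewrite (cls_cons _ _ v) cls_tpowD.
    by rewrite -!mulgA.
have [|h] := key u 0%R 1%g; first by rewrite absz0.
rewrite (uA _ _ step_ok) /= => -[<-].
by rewrite /tpow /= cls1 !mul1g invg1 mulg1 => ->.
Qed.

End Locality.

(* [(h, (f, c))]: the height [h], the exponent sums [f k] of the letters [a] at
   height [k], and the exponent sum [c] of the pairs made of a letter [a] at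
   height [k] followed by a letter [b] at height [k + i]. *)
Section Independence.
Variables (A : int -> bool) (i : int).
Hypothesis Ai : ~~ A i.

Let state : Type := int * ((int -> int) * int).

Let step (l : letter) (y : state) : state :=
  let: (h, (f, c)) := y in
  match l with
  | (None, e) => (h + (if e then 1 else -1), (f, c))%R
  | (Some false, e) =>
    (h, (fun k => f k + (if k == h then if e then 1 else -1 else 0), c))%R
  | (Some true, e) => (h, (f, c + (if e then f (h - i) else - f (h - i))))%R
  end.

Let stepV : inverse_steps step.
Proof.
move=> [[[]|] []] [h [f c]] /=; rewrite ?addrK ?subrK ?addrNK //; congr (_, (_, _)).
- by apply: funext => k; case: eqP => _; lia.
- by apply: funext => k; case: eqP => _; lia.
Qed.

Let run_tpow h s j : run step (h, s) (tpow j) = (h + j, s)%R.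
Proof. by case: s => f c; apply: (run_tpow_path (phi := fun k => (k, (f, c)))). Qed.

Let run_relator j h f c : run step (h, (f, c)) (relator j) =
  (h, (f, c + (if j == i then 1 else 0)))%R.
Proof.
rewrite /relator run_cons run_cat run_tpow run_cons run_cat run_tpow.
rewrite run_cons run_cat run_tpow run_cons run_tpow !addrK.
congr (_, (_, _)); first by apply: funext => k; case: eqP => _; lia.
have -> : (h + j - i == h)%R = (j == i) by apply/eqP/eqP; lia.
by case: eqP => _; lia.
Qed.

(** The action respects every relator except the [i]-th, which raises the counter [c] by one. *)
Lemma relator_neq1 : cls A (relator i) <> 1%g.
Proof.
rewrite -cls1 => /clsP /(_ _ step) rel.
have /rel : is_action step A.
  split=> // j Aj [h [f c]]; rewrite run_relator.
  by case: eqP => [ji|_]; [move: Ai; rewrite -ji Aj | rewrite addr0].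
by move=> /(_ (0%R, (fun=> 0%R, 0%R))); rewrite run_relator eqxx.
Qed.

End Independence.

(** * Translations *)

Section Shift.
Implicit Types (A : int -> bool) (j : int).

Definition shift j A : int -> bool := fun i => A (i - j)%R.

(** The substitution [b -> t^j b t^-j] turns the [i]-th relator into the [(i + j)]-th, up to free
    cancellation. *)
Definition twist_letter j (l : letter) : word :=
  if l is (Some true, e) then tpow j ++ l :: tpow (- j)%R else [:: l].

Definition twist j (u : word) : word := flatten [seq twist_letter j l | l <- u].

Lemma twist_cons j l u : twist j (l :: u) = twist_letter j l ++ twist j u.
Proof. by []. Qed.

Lemma twist_cat j u v : twist j (u ++ v) = twist j u ++ twist j v.
Proof. by rewrite /twist map_cat flatten_cat. Qed.

Lemma twist_tpow j k : twist j (tpow k) = tpow k.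
Proof. by rewrite /twist /tpow; elim: `|k| => //= n ->. Qed.

Lemma run_tpowK (Y : Type) (step : letter -> Y -> Y) (stepV : inverse_steps step) y k :
  run step (run step y (tpow k)) (tpow (- k)%R) = y.
Proof. by rewrite -run_tpowD // subrr. Qed.

Lemma run_tpowNK (Y : Type) (step : letter -> Y -> Y) (stepV : inverse_steps step) y k :
  run step (run step y (tpow (- k)%R)) (tpow k) = y.
Proof. by have := run_tpowK stepV y (- k)%R; rewrite opprK. Qed.

Lemma eqw_twist A A' j u v : (forall i, A i -> A' (i + j)%R) ->
  eqw A u v -> eqw A' (twist j u) (twist j v).
Proof.
move=> AA' uv Y step [stepV act] y.
pose step' l y := run step y (twist_letter j l).
have run' w z : run step' z w = run step z (twist j w).
  by elim: w z => //= l w IHw z; rewrite IHw /step' -run_cat.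
rewrite -!run'; apply: uv; split=> [l z|i Ai z].
  rewrite /step'; case: l => [[[]|] e] /=; rewrite ?run_cat /= ?run_cat /=.
  - by rewrite run_tpowNK // stepV run_tpowK.
  - by rewrite stepV.
  - by rewrite stepV.
rewrite run' -[RHS](act _ (AA' _ Ai)) /relator opprD (addrC (- i)%R).
rewrite !(twist_cons, twist_cat, twist_tpow) /twist_letter.
by rewrite !(run_cat, run_cons) !run_tpowD.
Qed.

Lemma twistK A j u : eqw A (twist (- j)%R (twist j u)) u.
Proof.
elim: u => [|l u IHu]; first by move=> Y step.
rewrite -[l :: u]cat1s 2!twist_cat; apply: eqw_cat IHu.
move=> Y step [stepV _] y; case: l => [[[]|] e] //.
rewrite twist_cons cats0 [twist_letter _ _]/= -cat1s !(twist_cat, twist_tpow).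
rewrite twist_cons cats0 [twist_letter _ _]/= opprK -cat1s !run_cat.
by rewrite !run_tpowK.
Qed.

Arguments twistK : clear implicits.

Definition twist_iso A j (g : Gr A) : Gr (shift j A) := cls _ (twist j (wrepr g)).

Lemma shiftP A j i : A i -> shift j A (i + j)%R.
Proof. by rewrite /shift addrK. Qed.

Lemma shiftNP A j i : shift j A i -> A (i - j)%R.
Proof. by []. Qed.

Lemma twist_isoE A j u : twist_iso j (cls A u) = cls _ (twist j u).
Proof. by apply/clsP/eqw_twist; [exact: shiftP | exact: repr_cls]. Qed.

Lemma twist_isoM A j : {morph @twist_iso A j : g h / (g * h)%g}.
Proof.
move=> g h; rewrite -(cls_repr g) -(cls_repr h) -clsM !twist_isoE.
by rewrite twist_cat clsM.
Qed.

Lemma twist_iso_inj A j : injective (@twist_iso A j).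
Proof.
move=> g h; rewrite -(cls_repr g) -(cls_repr h) !twist_isoE => /clsP.
move=> /(eqw_twist (@shiftNP A j)) gh; apply/clsP.
exact: eqw_trans (eqw_sym (twistK A j (wrepr g))) (eqw_trans gh (twistK A j _)).
Qed.

Lemma twist_iso_surj A j h : exists g, @twist_iso A j g = h.
Proof.
exists (cls A (twist (- j)%R (wrepr h))).
rewrite twist_isoE -[RHS]cls_repr; apply/clsP.
by have := twistK (shift j A) (- j)%R (wrepr h); rewrite opprK.
Qed.

End Shift.

(** * Invariance of first-order truth under isomorphism *)

Lemma env_cons_comp (S T : Type) (h : S -> T) n x (e : 'I_n -> S) :
  env_cons (h x) (h \o e) = h \o env_cons x e.
Proof. by apply: funext => i; rewrite /env_cons /=; case: unlift. Qed.

Section Isomorphism.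
Variables (G H : groupType) (f : G -> H).
Hypothesis fM : {morph f : x y / (x * y)%g}.

Let f1 : f 1%g = 1%g.
Proof. by apply: (mulgI (f 1%g)); rewrite -fM !mulg1. Qed.

Let fV x : f x^-1%g = (f x)^-1%g.
Proof. by apply: (mulgI (f x)); rewrite -fM !mulgV. Qed.

Let gterm_eval_morph n (e : 'I_n -> G) t : f (gterm_eval e t) = gterm_eval (f \o e) t.
Proof. by elim: t => //= [t IHt u IHu|t IHt]; rewrite ?fM ?fV ?IHt ?IHu. Qed.

Hypotheses (f_inj : injective f) (f_surj : forall h, exists g, f g = h).

Lemma gholds_iso n (phi : gformula n) (e : 'I_n -> G) :
  gholds phi e <-> gholds phi (f \o e).
Proof.
elim: phi e => {n} /=.
- by move=> n t u e; rewrite -!gterm_eval_morph; split=> [->|/f_inj].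
- by [].
- by move=> n p IHp e; rewrite IHp.
- by move=> n p IHp q IHq e; rewrite IHp IHq.
- by move=> n p IHp q IHq e; rewrite IHp IHq.
- by move=> n p IHp q IHq e; rewrite IHp IHq.
- move=> n p IHp e; split=> [pe h|pe g].
    by have [g <-] := f_surj h; rewrite env_cons_comp -IHp.
  by rewrite IHp -env_cons_comp.
- move=> n p IHp e; split=> [[g pe]|[h]].
    by exists (f g); rewrite env_cons_comp -IHp.
  by have [g <-] := f_surj h; rewrite env_cons_comp -IHp; exists g.
Qed.

Lemma elementarily_equivalent_iso : elementarily_equivalent G H.
Proof.
move=> phi; rewrite /satisfies gholds_iso.
by have -> : f \o @env_nil G = @env_nil H by apply: funext => -[].
Qed.

End Isomorphism.

Lemma elementarily_equivalent_shift A j :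
  elementarily_equivalent (Gr A) (Gr (shift j A)).
Proof.
exact: elementarily_equivalent_iso (@twist_isoM A j) (@twist_iso_inj A j)
  (@twist_iso_surj A j).
Qed.

(** * Baire category and elementary equivalence *)

Section CantorSpace.
Implicit Types (A B Q : int -> bool) (U D P : (int -> bool) -> Prop).

Definition agree (m : nat) A B : Prop := forall i : int, `|i| <= m -> A i = B i.

Definition cyl_open U : Prop :=
  forall A, U A -> exists m, forall B, agree m A B -> U B.

Definition dense_open D : Prop :=
  cyl_open D /\ forall A m, exists B, agree m A B /\ D B.

Lemma agree_sym m A B : agree m A B -> agree m B A.
Proof. by move=> AB i /AB. Qed.

Lemma agree_trans m A B C : agree m A B -> agree m B C -> agree m A C.
Proof. by move=> AB BC i im; rewrite AB ?BC. Qed.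

(* As there are finitely many patterns on the window of radius [m], one pattern
   on an annulus around it forces any configuration into [D]. *)
Lemma dense_open_annulus D m : dense_open D ->
  exists M Q, m <= M /\
  forall B, (forall i : int, m < `|i| <= M -> B i = Q i) -> D B.
Proof.
move=> [Dopen Ddense].
pose pat (p : {ffun 'I_(2 * m).+1 -> bool}) (i : int) := p (inord `|(i + m)%R|).
suff: forall s : seq {ffun 'I_(2 * m).+1 -> bool}, exists M Q, m <= M /\
    forall p, p \in s -> forall B, agree m (pat p) B ->
    (forall i : int, m < `|i| <= M -> B i = Q i) -> D B.
  move=> /(_ (enum {ffun 'I_(2 * m).+1 -> bool})) [M [Q [mM MQ]]].
  exists M, Q; split=> // B BQ.
  apply: (MQ [ffun j : 'I_(2 * m).+1 => B (Posz j - Posz m)%R] _ B) => //.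
    by rewrite mem_enum.
  move=> i im; rewrite /pat ffunE inordK; last by lia.
  by congr B; lia.
elim=> [|p s [M [Q [mM MQ]]]]; first by exists m, xpred0.
(* Complete [p] by the annulus found so far and enter [D]: the values of [C] up to [M] still force
   the earlier patterns, and those up to [M'] force [p]. *)
have [C [QC DC]] := Ddense (fun i => if `|i| <= m then pat p i else Q i) M.
have [M' CM'] := Dopen _ DC.
exists (maxn M M'), C; split=> [|p']; first by rewrite leq_max mM.
rewrite inE => /predU1P[-> B pB BC|/MQ p's B pB BC].
  apply: CM' => i iM'; case: (leqP `|i| m) => im; last by rewrite BC //; lia.
  by rewrite -QC ?im ?pB //; lia.
apply: p's => // i iM; rewrite BC; last by lia.
by rewrite -QC; [case: leqP => //; lia | lia].
Qed.

(** Free windows, where arbitrary values [Z n] can be prescribed, alternate with annuli whose fixed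
    pattern forces [E n]. The radii are chosen before [A] and [Z], so one sequence of windows serves
    all prescriptions. *)
Lemma fusion (E : nat -> (int -> bool) -> Prop) (R : nat -> nat -> nat) (m0 : nat) :
  (forall n, dense_open (E n)) -> (forall n m, m <= R n m) ->
  exists m : nat -> nat, [/\ m 0 = m0, forall n, n <= m n &
    forall A (Z : nat -> int -> bool), exists B,
    [/\ agree m0 A B,
        forall n (i : int), m n < `|i| <= R n (m n) -> B i = Z n i &
        forall n, E n B]].
Proof.
move=> Edo leR.
have /choice[F FP] (nm : nat * nat) : exists MQ : nat * (int -> bool), nm.2 < MQ.1 /\
    forall B, (forall i : int, nm.2 < `|i| <= MQ.1 -> B i = MQ.2 i) -> E nm.1 B.
  have [M [Q [mM MQ]]] := dense_open_annulus nm.2 (Edo nm.1).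
  exists (maxn M nm.2.+1, Q); split=> [|B BQ] /=; first by rewrite leq_max ltnSn orbT.
  by apply: MQ => i iM; apply: BQ => /=; lia.
have [m [m00 mE]] : exists m : nat -> nat,
    m 0 = m0 /\ forall n, m n.+1 = (F (n, R n (m n))).1.
  by exists (fix m n := if n is k.+1 then (F (k, R k (m k))).1 else m0).
have mS n : R n (m n) < m n.+1 by rewrite mE; have [] := FP (n, R n (m n)).
have m_mono n : m n < m n.+1 by apply: leq_ltn_trans (mS n); exact: leR.
have m_le n : n <= m n by elim: n => // n IHn; exact: leq_ltn_trans (m_mono n).
exists m; split=> // A Z.
(* [C n] is the configuration after [n] stages; passing to [C n.+1] changes it only outside radius
   [m n]. *)
have [C [C0 CS]] : exists C : nat -> int -> bool, C 0 = A /\ forall n i, C n.+1 i =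
    if `|i| <= m n then C n i else
    if `|i| <= R n (m n) then Z n i else (F (n, R n (m n))).2 i.
  by exists (fix C n : int -> bool := if n is k.+1 then fun i =>
    if `|i| <= m k then C k i else
    if `|i| <= R k (m k) then Z k i else (F (k, R k (m k))).2 i else A).
have C_agree n k : agree (m n) (C n) (C (k + n)).
  elim: k => [|k IHk] // i im; rewrite IHk // addSn CS.
  suff -> : `|i| <= m (k + n) by [].
  apply: leq_trans im _; elim: k {IHk} => // k; rewrite addSn => h.
  exact: leq_trans h (ltnW (m_mono _)).
(* Since [n <= m n], the value at [i] is final from stage [|i|] on. *)
pose B (i : int) := C `|i| i.
have BE n : agree (m n) (C n) B.
  move=> i im; rewrite /B; case: (leqP n `|i|) => ni.
    by rewrite -(subnK ni); apply: C_agree.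
  by rewrite -{1}(subnK (ltnW ni)) -C_agree //; exact: m_le.
exists B; split=> [|n i /andP[mi iR]|n]; first by rewrite -C0 -m00; exact: BE.
  rewrite -(BE n.+1) ?CS; first by rewrite leqNgt mi iR.
  exact: leq_trans iR (ltnW (mS n)).
have [_] := FP (n, R n (m n)); apply=> i /andP[Ri im].
rewrite -(BE n.+1) ?mE // CS leqNgt (leq_ltn_trans (leR _ _) Ri) /=.
by rewrite leqNgt Ri.
Qed.

Lemma baire_category (I : countType) (E : I -> (int -> bool) -> Prop) A m :
  (forall i, dense_open (E i)) -> exists B, agree m A B /\ forall i, E i B.
Proof.
move=> Edo.
pose E' n := if @unpickle I n is Some i then E i else fun=> True.
(* With [R n m = m] the windows are empty and prescribe nothing. *)
have [||m' [_ _ /(_ A (fun=> A))[B [AB _ E'B]]]] := @fusion E' (fun _ m => m) m.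
- move=> n; rewrite /E'; case: unpickle => // ; split=> [C _|C k]; first by exists 0.
  by exists C.
- by [].
by exists B; split=> // i; have := E'B (pickle i); rewrite /E' pickleK.
Qed.

Lemma dense_open_shift D j : dense_open D -> dense_open (fun A => D (shift j A)).
Proof.
move=> [Dopen Ddense]; split=> [A /Dopen[m mD]|A m].
  by exists (m + `|j|) => B AB; apply: mD => i im; apply: AB; lia.
have [B [AB DB]] := Ddense (shift j A) (m + `|j|).
exists (shift (- j)%R B); split.
  by move=> i im; rewrite /shift opprK -AB ?/shift ?addrK //; lia.
suff -> : shift j (shift (- j)%R B) = B by [].
by apply: funext => i; rewrite /shift opprK subrK.
Qed.

(** This is the property of Baire, the comeager set being given by a sequence of dense open sets. *)
Definition has_baire P : Prop := exists U (E : nat -> (int -> bool) -> Prop),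
  [/\ cyl_open U, forall n, dense_open (E n) &
      forall A, (forall n, E n A) -> (P A <-> U A)].

Lemma has_baire_ext P P' : (forall A, P A <-> P' A) -> has_baire P -> has_baire P'.
Proof.
move=> PP' [U [E [Uo Edo PU]]]; exists U, E; split=> // A EA.
by rewrite -PP' PU.
Qed.

Lemma dense_openT : dense_open (fun=> True).
Proof. by split=> [A _|A m]; [exists 0 | exists A]. Qed.

Lemma has_baire_clopen P :
  (forall A, exists m, forall B, agree m A B -> (P A <-> P B)) -> has_baire P.
Proof.
move=> Pclopen; exists P, (fun _ _ => True); split=> // [A PA|_]; last exact: dense_openT.
by have [m mP] := Pclopen A; exists m => B /mP <-.
Qed.

Lemma has_baireN P : has_baire P -> has_baire (fun A => ~ P A).
Proof.
move=> [U [E [Uo Edo PU]]].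
(* [V] is the exterior of [U], so the union of [U] and [V] is open and dense; it becomes the
   condition of index 0. *)
pose V A := exists m, forall B, agree m A B -> ~ U B.
have Vo : cyl_open V.
  move=> A [m AV]; exists m => B AB; exists m => C BC.
  by apply: AV; apply: agree_trans BC.
pose E' n := if n is k.+1 then E k else fun A => U A \/ V A.
exists V, E'; split=> // [[|n]|A EA]; last 2 first.
- exact: Edo.
- have {}PU := PU A (fun n => EA n.+1); split=> [nPA|[m mU] /PU]; last exact: mU.
  by case: (EA 0) => // /PU.
  split=> [A [/Uo|/Vo] [m mU]|A m].
  - by exists m => B /mU; left.
  - by exists m => B /mU; right.
  have [[B AB]|AV] := pselect (exists2 B, agree m A B & U B).
    by exists B; split=> //; left.
  exists A; split=> //; right; exists m => B AB UB.
  by apply: AV; exists B.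
Qed.

Lemma has_baire_ex (I : countType) (P : I -> (int -> bool) -> Prop) :
  (forall i, has_baire (P i)) -> has_baire (fun A => exists i, P i A).
Proof.
move=> /choice[U /choice[E UE]].
pose E' n := if @unpickle (I * nat)%type n is Some (i, k) then E i k else fun=> True.
exists (fun A => exists i, U i A), E'; split.
- move=> A [i UiA]; have [Uo _ _] := UE i; have [m mU] := Uo _ UiA.
  by exists m => B /mU UiB; exists i.
- move=> n; rewrite /E'; case: unpickle => [[i k]|]; last exact: dense_openT.
  by have [] := UE i.
move=> A EA; suff PU i : P i A <-> U i A by split=> -[i /PU PiA]; exists i.
have [_ _] := UE i; apply=> n.
by have := EA (pickle (i, n)); rewrite /E' pickleK.
Qed.

Lemma has_baire_or P P' :
  has_baire P -> has_baire P' -> has_baire (fun A => P A \/ P' A).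
Proof.
move=> bP bP'; have := @has_baire_ex bool (fun b => if b then P else P').
move=> /(_ _)/(has_baire_ext _); apply; last by case.
by move=> A; split=> [[[]]|[]]; [left | right | exists true | exists false].
Qed.

Lemma has_baire_and P P' :
  has_baire P -> has_baire P' -> has_baire (fun A => P A /\ P' A).
Proof.
move=> bP bP'; have := has_baireN (has_baire_or (has_baireN bP) (has_baireN bP')).
apply: has_baire_ext => A; split=> [/not_orP[/contrapT ? /contrapT]|] //.
by move=> [? ?] [].
Qed.

Lemma has_baire_imply P P' :
  has_baire P -> has_baire P' -> has_baire (fun A => P A -> P' A).
Proof.
move=> bP bP'; have := has_baire_or (has_baireN bP) bP'.
apply: has_baire_ext => A; split=> [[]|] // PP'.
by have [/PP'|] := pselect (P A); [right | left].
Qed.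

Lemma has_baire_all (I : countType) (P : I -> (int -> bool) -> Prop) :
  (forall i, has_baire (P i)) -> has_baire (fun A => forall i, P i A).
Proof.
move=> bP; have := has_baireN (has_baire_ex (fun i => has_baireN (bP i))).
apply: has_baire_ext => A; split=> [nP i|PA [i]]; last exact.
by apply: contrapT => PiA; apply: nP; exists i.
Qed.

End CantorSpace.

(** * Baire property of first-order truth *)

Lemma eqw_agree A B u v : agree (2 * (size u + size v)) A B ->
  eqw A u v <-> eqw B u v.
Proof.
suff imp A' B' : agree (2 * (size u + size v)) A' B' -> eqw A' u v -> eqw B' u v.
  by move=> AB; split; apply: imp => //; exact: agree_sym.
move=> AB /clsP uv; apply/clsP/(mulIg (cls B' v)^-1%g).
rewrite mulgV -clsV -clsM -cls1; apply/clsP/(@eqw_local A' _ (size u + size v)).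
- by move=> i im; rewrite AB.
- by rewrite size_cat size_rev size_map.
- by apply/clsP; rewrite clsM uv clsV mulgV.
Qed.

Fixpoint term_word n (e : 'I_n -> word) (t : gterm n) : word :=
  match t with
  | GVar i => e i
  | GOne => [::]
  | GMul t1 t2 => term_word e t1 ++ term_word e t2
  | GInv t1 => winv (term_word e t1)
  end.

Lemma term_wordE A n (e : 'I_n -> word) t :
  gterm_eval (cls A \o e) t = cls A (term_word e t).
Proof. by elim: t => //= [t -> u ->|t ->]; rewrite ?clsM ?clsV. Qed.

(** Words name the elements of every [Gr A] at once, so quantifiers become countable unions and
    intersections over words; atomic formulas are clopen by [eqw_agree]. *)
Lemma has_baire_gholds n (phi : gformula n) (e : 'I_n -> word) :
  has_baire (fun A => gholds phi (cls A \o e)).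
Proof.
elim: phi e => {n} /=.
- move=> n t u e; apply: has_baire_clopen => A.
  exists (2 * (size (term_word e t) + size (term_word e u))) => B AB.
  by rewrite !term_wordE !clsP; exact: eqw_agree.
- by move=> n _; apply: has_baire_clopen => A; exists 0.
- by move=> n p IHp e; exact: has_baireN.
- by move=> n p IHp q IHq e; exact: has_baire_and.
- by move=> n p IHp q IHq e; exact: has_baire_or.
- by move=> n p IHp q IHq e; exact: has_baire_imply.
- move=> n p IHp e; have := has_baire_all (fun w : word => IHp (env_cons w e)).
  apply: has_baire_ext => A; split=> pe x; last by rewrite -env_cons_comp.
  by rewrite -(cls_repr x) env_cons_comp.
- move=> n p IHp e; have := has_baire_ex (fun w : word => IHp (env_cons w e)).
  apply: has_baire_ext => A; split=> -[x px].
    by exists (cls A x); rewrite env_cons_comp.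
  by exists (wrepr x); rewrite -env_cons_comp cls_repr.
Qed.

(** * Countability of the language *)

Fixpoint decode_term n (t : GenTree.tree nat) : gterm n :=
  match t with
  | GenTree.Leaf k => if insub k is Some i then GVar i else GOne
  | GenTree.Node 0 [:: t1; t2] => GMul (decode_term n t1) (decode_term n t2)
  | GenTree.Node 1 [:: t1] => GInv (decode_term n t1)
  | _ => GOne
  end.

Lemma decode_term_surj n (t : gterm n) : exists c, decode_term n c = t.
Proof.
elim: t => [i||t [c ct] u [d du]|t [c ct]].
- by exists (GenTree.Leaf (i : nat)); rewrite /= valK.
- by exists (GenTree.Node 2 [::]).
- by exists (GenTree.Node 0 [:: c; d]); rewrite /= ct du.
- by exists (GenTree.Node 1 [:: c]); rewrite /= ct.
Qed.

(** The number of variables is an argument and not part of the code, so plain trees enumerate the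
    dependent family; [GFalse] is the default. *)
Fixpoint decode (c : GenTree.tree nat) n : gformula n :=
  match c with
  | GenTree.Node 0 [:: c1; c2] => GEq (decode_term n c1) (decode_term n c2)
  | GenTree.Node 1 [:: c1] => GNot (decode c1 n)
  | GenTree.Node 2 [:: c1; c2] => GAnd (decode c1 n) (decode c2 n)
  | GenTree.Node 3 [:: c1; c2] => GOr (decode c1 n) (decode c2 n)
  | GenTree.Node 4 [:: c1; c2] => GImplies (decode c1 n) (decode c2 n)
  | GenTree.Node 5 [:: c1] => GForall (decode c1 n.+1)
  | GenTree.Node 6 [:: c1] => GExists (decode c1 n.+1)
  | _ => GFalse n
  end.

Lemma decode_surj n (phi : gformula n) : exists c, decode c n = phi.
Proof.
elim: phi => {n}.
- move=> n t u; have [c <-] := decode_term_surj t; have [d <-] := decode_term_surj u.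
  by exists (GenTree.Node 0 [:: c; d]).
- by move=> n; exists (GenTree.Node 7 [::]).
- by move=> n p [c <-]; exists (GenTree.Node 1 [:: c]).
- by move=> n p [c <-] q [d <-]; exists (GenTree.Node 2 [:: c; d]).
- by move=> n p [c <-] q [d <-]; exists (GenTree.Node 3 [:: c; d]).
- by move=> n p [c <-] q [d <-]; exists (GenTree.Node 4 [:: c; d]).
- by move=> n p [c <-]; exists (GenTree.Node 5 [:: c]).
- by move=> n p [c <-]; exists (GenTree.Node 6 [:: c]).
Qed.

(* Far enough translates of two windows are disjoint. *)
Lemma shift_transitive (U V : (int -> bool) -> Prop) A B : cyl_open U -> cyl_open V ->
  U A -> V B -> exists j C m, forall C', agree m C C' -> U C' /\ V (shift j C').
Proof.
move=> Uo Vo /Uo[m mU] /Vo[m' mV].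
pose j : int := (m + m').+1.
exists j, (fun i => if `|i| <= m then A i else B (i + j)%R), (m + m' + `|j|) => C' CC'.
split; [apply: mU => i im | apply: mV => i im].
  by rewrite -CC' ?im //; lia.
rewrite /shift -CC'; last by lia.
by rewrite subrK ifF //; lia.
Qed.

(* A topological zero-one law: a sentence and its negation cannot both hold on
   comeager subsets of nonempty open sets, since the shift, which preserves the
   isomorphism type, is topologically transitive. *)
Lemma generic_elementarily_equivalent :
  exists E : nat -> (int -> bool) -> Prop, (forall n, dense_open (E n)) /\
  forall A B, (forall n, E n A) -> (forall n, E n B) ->
  elementarily_equivalent (Gr A) (Gr B).
Proof.
have bsat c : has_baire (fun A => satisfies (Gr A) (decode c 0)).
  have := has_baire_gholds (decode c 0) (@env_nil word); apply: has_baire_ext => A.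
  by rewrite /satisfies; have -> : cls A \o @env_nil word = @env_nil (Gr A)
    by apply: funext => -[].
have /choice[U /choice[E UE]] := bsat.
pose E' n := if @unpickle (GenTree.tree nat * nat)%type n is Some (c, k)
  then E c k else fun=> True.
have E'do n : dense_open (E' n).
  rewrite /E'; case: unpickle => [[c k]|]; last exact: dense_openT.
  by have [] := UE c.
have UP c A : (forall n, E' n A) -> satisfies (Gr A) (decode c 0) <-> U c A.
  move=> EA; have [_ _] := UE c; apply=> n.
  by have := EA (pickle (c, n)); rewrite /E' pickleK.
exists E'; split=> // A0 B0 EA0 EB0.
suff imp A B phi : (forall n, E' n A) -> (forall n, E' n B) ->
    satisfies (Gr A) phi -> satisfies (Gr B) phi.
  by move=> phi; split; apply: imp.
move=> EA EB; have [c <-] := decode_surj phi.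
move=> /(UP _ _ EA) UA; apply: contrapT => nB.
pose d := GenTree.Node 1 [:: c].
have {nB} /(UP d _ EB) UB : satisfies (Gr B) (decode d 0) by [].
have [[Uco _ _] [Udo _ _]] := (UE c, UE d).
have [j [C [m CU]]] := shift_transitive Uco Udo UA UB.
(* By Baire category, [C'] and its translate by [j] can both be generic, while the sentence holds
   for one and fails for the other. *)
pose F (bn : bool * nat) A := if bn.1 then E' bn.2 A else E' bn.2 (shift j A).
have [[[] n]|C' [CC' FC']] := @baire_category _ F C m; first exact: E'do.
  exact/dense_open_shift/E'do.
have [UC' UsC'] := CU _ CC'.
have := (UP d (shift j C') (fun n => FC' (false, n))).2 UsC'; apply.
apply/(elementarily_equivalent_shift C' j)/UP => // n.
exact: (FC' (true, n)).
Qed.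

(** * Quasi-isometries *)

Definition ball A (n : nat) (g : Gr A) : Prop := exists2 u, size u <= n & cls A u = g.

Section Ball.
Variable A : int -> bool.
Implicit Types g h : Gr A.

Lemma ball_le m n g : m <= n -> ball m g -> ball n g.
Proof. by move=> mn [u um <-]; exists u => //; apply: leq_trans mn. Qed.

Lemma ball1 n : ball n (1%g : Gr A).
Proof. by exists [::]. Qed.

Lemma ball_cls u : ball (size u) (cls A u).
Proof. by exists u. Qed.

Lemma ballV n g : ball n g -> ball n g^-1%g.
Proof. by move=> [u un <-]; exists (winv u); rewrite ?clsV // size_rev size_map. Qed.

Lemma ballM m n g h : ball m g -> ball n h -> ball (m + n) (g * h)%g.
Proof.
move=> [u um <-] [v vn <-]; exists (u ++ v); rewrite ?clsM //.
by rewrite size_cat leq_add.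
Qed.

Lemma word_length_ball (S : genset (Gr A)) :
  exists c, forall g, ball (c * word_length S g) g.
Proof.
pose len (s : Gr A) := size (wrepr s).
pose c := \max_(s <- S) len s.
have ball_len s : ball (len s) s by exists (wrepr s) => //; exact: cls_repr.
have lenS s : s \in (S : seq _) -> len s <= c by move=> sS; exact: leq_bigmax_seq.
exists c => g; have [w [wS <- <-]] := word_length_spelled S g.
elim: w wS => [_|s w IHw /= /andP[sS wS]]; first by rewrite big_nil; exact: ball1.
rewrite big_cons mulnS; apply: ballM (IHw wS).
case/orP: sS => /lenS cs; first exact: ball_le cs (ball_len s).
by rewrite -[s]invgK; apply: ballV; exact: ball_le cs (ball_len _).
Qed.

Lemma ball_word_length (S : genset (Gr A)) :
  exists c, forall n g, ball n g -> word_length S g <= c * n.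
Proof.
pose c := \max_(l : letter) word_length S (cls A [:: l]).
exists c => n g [u un <-]; apply: leq_trans (leq_mul (leqnn c) un) => {n g un}.
elim: u => [|l u IHu]; first by rewrite word_length1.
rewrite cls_cons /= mulnS; apply: leq_trans (word_lengthM _ _ _) (leq_add _ IHu).
exact: (@leq_bigmax _ (fun l => word_length S (cls A [:: l]))).
Qed.

Lemma Gr_finitely_generated : finitely_generated (Gr A).
Proof.
exists [seq cls A [:: l] | l : letter] => g.
exists [seq cls A [:: l] | l <- wrepr g].
  by apply/allP => _ /mapP[l _ ->]; rewrite fintype.image_f.
rewrite -[RHS]cls_repr; elim: (wrepr g) => [|l u IHu] /=; first by rewrite big_nil.
by rewrite big_cons IHu -cls_cons.
Qed.

End Ball.

(** Quasi-isometry for the generators [a], [b], [t] with a single natural constant; the lower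
    estimate is written as a bound on distances in the source, which avoids division. *)
Definition coarse_equiv A B (N : nat) (f : Gr A -> Gr B) : Prop :=
  [/\ forall n x g, ball n g -> ball (N * n + N) ((f x)^-1 * f (x * g))%g,
      forall n x x', ball n ((f x)^-1 * f x')%g -> ball (N * n + N) (x^-1 * x')%g &
      forall y, exists x, ball N ((f x)^-1 * y)%g].

Lemma coarse_equiv_le A B M N (f : Gr A -> Gr B) :
  M <= N -> coarse_equiv M f -> coarse_equiv N f.
Proof.
move=> MN [f1 f2 f3]; split=> [n x g /(f1 _ x)|n x x' /f2|y].
- by apply: ball_le; rewrite leq_add // leq_mul.
- by apply: ball_le; rewrite leq_add // leq_mul.
- by have [x /(ball_le MN)] := f3 y; exists x.
Qed.

Lemma quasi_isometric_coarse_equiv (R : realType) A B :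
  quasi_isometric_groups R (Gr A) (Gr B) ->
  exists N (f : Gr A -> Gr B), coarse_equiv N f.
Proof.
move=> [S [T [f [L [C [L1 C0 fLC fC]]]]]].
have [cS ballS] := word_length_ball S; have [cT ballT] := word_length_ball T.
have [dS lenS] := ball_word_length S; have [dT lenT] := ball_word_length T.
pose M := (Num.bound L + Num.bound C)%N.
have LM : (L <= M%:R)%R.
  apply: le_trans (ltW (archi_boundP (le_trans ler01 L1))) _.
  by rewrite ler_nat leq_addr.
have CM : (C <= M%:R)%R.
  by apply: le_trans (ltW (archi_boundP C0)) _; rewrite ler_nat leq_addl.
have up x x' : word_length T ((f x)^-1 * f x')%g <= M * word_length S (x^-1 * x')%g + M.
  have /andP[_] := fLC x x'; rewrite -(ler_nat R) natrD natrM => h.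
  by apply: le_trans h _; apply: lerD => //; apply: ler_wpM2r.
have down x x' : word_length S (x^-1 * x')%g <= M * (word_length T ((f x)^-1 * f x')%g + M).
  have /andP[+ _] := fLC x x'; rewrite lerBlDr ler_pdivrMl; last first.
    by apply: lt_le_trans L1.
  rewrite -(ler_nat R) natrM natrD => h; apply: le_trans h _.
  apply: ler_pM => //; first exact: le_trans L1.
    by apply: addr_ge0.
  by apply: lerD.
pose a := cT * (M * dS); pose b := cT * M; pose c := cS * (M * dT); pose d := cS * (M * M).
exists (a + b + c + d), (f : Gr A -> Gr B).
split=> [n x g /lenS gn|n x x' /lenT xn|y].
- apply: ball_le (ballT _); have := up x (x * g)%g; rewrite mulKg => fx.
  have {fx} : word_length T ((f x)^-1 * f (x * g))%g <= M * (dS * n) + M.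
    by apply: leq_trans fx _; rewrite leq_add2r leq_mul2l gn orbT.
  move=> /(leq_mul (leqnn cT)) /leq_trans; apply.
  have -> : cT * (M * (dS * n) + M) = a * n + b by rewrite /a /b; lia.
  by move: (a) (b) (c) (d) => ? ? ? ?; nia.
- apply: ball_le (ballS _); have fx := down x x'.
  have {fx} : word_length S (x^-1 * x')%g <= M * (dT * n + M).
    by apply: leq_trans fx _; rewrite leq_mul2l leq_add2r xn orbT.
  move=> /(leq_mul (leqnn cS)) /leq_trans; apply.
  have -> : cS * (M * (dT * n + M)) = c * n + d by rewrite /c /d; lia.
  by move: (a) (b) (c) (d) => ? ? ? ?; nia.
- have [x fxy] := fC y; exists x; apply: ball_le (ballT _).
  have : word_length T ((f x)^-1 * y)%g <= M.
    by rewrite -(ler_nat R); apply: le_trans fxy _.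
  by move=> /(leq_mul (leqnn cT)) /leq_trans; apply; rewrite -/b; lia.
Qed.

(* Let [w_i] be the [i]-th relator, with [i] in [B] huge. Then the projection
   to [G_B] of the group [K] obtained by dropping the relator [w_i] is
   injective on large balls. Lifting [y^-1 z] to [K] for nearby [y], [z]
   defines a cocycle at scale [s], whose pull-back by the coarse equivalence
   [f] makes [F_3] act on [G_A * K]. As [A] has a gap above [r], loops of [G_A]
   of length linear in [i] are filled at scale [s], so they act trivially,
   while the loop [w_i] of [G_B], transported to [G_A], does not. *)
Section GapObstruction.
Variables (A B : int -> bool) (f : Gr A -> Gr B) (N r s : nat) (i : int).
Hypothesis fN : coarse_equiv N f.
(** Neighbours in [G_B] have approximate preimages under [f] at distance at most [D]. *)
Let D := N * (2 * N + 1) + N.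
Hypothesis Bi : B i.
(** The scale [s] accommodates the [f]-images of words of length [D] and of relators up to [r], and
    distances up to [2 * N + 1]. By [si], relations of length at most [3 * s] do not see the [i]-th
    relator. By [gap], loops as long as the transported relator need only relators up to [r]. *)
Hypotheses (Ds : N * D + N <= s) (Ns : 2 * N + 1 <= s).
Hypotheses (rs : N * (4 * r + 4) + N <= s) (si : 6 * s < `|i|).
Hypothesis gap : forall j : int, `|j| <= 2 * (D * (4 * `|i| + 4)) -> A j -> `|j| <= r.

Let B' (j : int) := B j && (j != i).
Let K := Gr B'.

Let cls_small u v : 2 * (size u + size v) < `|i| ->
  cls B u = cls B v -> cls B' u = cls B' v.
Proof.
move=> uvi /clsP uv; apply/clsP/(eqw_agree _ : _ <-> eqw B u v) => // j juv.
by rewrite /B'; case: eqP juv => [->|_]; rewrite ?andbT //; lia.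
Qed.

(** A local section of the projection from [K], unambiguous on the ball of radius [s] by
    [cls_small]; 1 is a default value elsewhere. *)
Let lift (g : Gr B) : K :=
  if pselect (ball s g) is left sg then cls B' (s2val (cid2 sg)) else 1%g.

Let liftE u : size u <= s -> lift (cls B u) = cls B' u.
Proof.
move=> us; rewrite /lift; case: pselect => [su|]; last by case; exists u.
by case: cid2 => v vs /= uv; apply: cls_small uv; lia.
Qed.

Let liftM g h : ball s g -> ball s h -> ball s (g * h)%g ->
  lift (g * h)%g = (lift g * lift h)%g.
Proof.
move=> [u us <-] [v vs <-] [w ws wuv]; rewrite -wuv !liftE // -clsM.
by apply: cls_small; rewrite ?size_cat ?clsM //; lia.
Qed.

Let lift1 : lift 1%g = 1%g.
Proof. by rewrite -cls1 liftE. Qed.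

Let liftV g : ball s g -> lift g^-1%g = (lift g)^-1%g.
Proof.
move=> sg; apply: (mulgI (lift g)).
rewrite -liftM ?mulgV ?lift1 //; first exact: ballV.
exact: ball1.
Qed.

Let step (l : letter) (y : Gr A * K) : Gr A * K :=
  (y.1 * cls A [:: l], y.2 * lift ((f y.1)^-1 * f (y.1 * cls A [:: l])))%g.

Let f_ball n x g : N * n + N <= s -> ball n g -> ball s ((f x)^-1 * f (x * g))%g.
Proof. by move=> ns /(let: And3 f1 _ _ := fN in f1 _ x); exact: ball_le. Qed.

Let step_ball x l : ball s ((f x)^-1 * f (x * cls A [:: l]))%g.
Proof.
apply: (f_ball (n := 1)); last exact: (ball_cls _ [:: l]).
by have := rs; nia.
Qed.

Let stepV : inverse_steps step.
Proof.
move=> l [x k]; rewrite /step /= cls_linv mulgK; congr (_, _).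
have := step_ball x l; set g := (_ * f _)%g => sg.
have -> : ((f (x * cls A [:: l]))^-1 * f x)%g = g^-1%g by rewrite invgM invgK.
by rewrite liftV // mulgK.
Qed.

(** While the images under [f] stay within [s] of [f x], [liftM] makes the increments telescope. *)
Let run_short u x k : N * size u + N <= s ->
  run step (x, k) u = (x * cls A u, k * lift ((f x)^-1 * f (x * cls A u)))%g.
Proof.
elim/last_ind: u => [_|u l IHu]; first by rewrite /= cls1 mulg1 mulVg lift1 mulg1.
rewrite size_rcons -cats1 run_cat clsM => us.
rewrite IHu /=; last by apply: leq_trans us; rewrite leq_add2r leq_mul2l leqnSn orbT.
rewrite /step /= !mulgA; congr (_, _); rewrite -(mulgA k); congr (_ * _)%g.
have fE (a b c : Gr B) : (a^-1 * b * (b^-1 * c) = a^-1 * c)%g by rewrite -mulgA mulVKg.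
rewrite -liftM ?fE //.
- apply: (f_ball (n := size u)); last exact: ball_cls.
  by apply: leq_trans us; rewrite leq_add2r leq_mul2l leqnSn orbT.
- rewrite -mulgA -clsM; apply: (f_ball (n := (size u).+1)) => //.
  by rewrite -addn1 -(size_cat u [:: l]); exact: ball_cls.
Qed.

Let run_fst u x k : (run step (x, k) u).1 = (x * cls A u)%g.
Proof.
elim: u x k => [|l u IHu] x k /=; first by rewrite cls1 mulg1.
by rewrite IHu (cls_cons _ _ u) mulgA.
Qed.

Let step_ok : is_action step (fun j => A j && (`|j| <= r)).
Proof.
split=> // j /andP[Aj jr] [x k]; rewrite run_short.
  by rewrite (cls_relator Aj) mulg1 mulVg lift1 mulg1.
by apply: leq_trans rs; rewrite size_relator; nia.
Qed.

Let run_loop u y : size u <= D * (4 * `|i| + 4) -> cls A u = 1%g -> run step y u = y.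
Proof.
move=> uD /clsP uA; have : eqw (fun j => A j && (`|j| <= r)) u [::].
  by apply: (eqw_local (A := A) _ uD) => // j jD Aj; rewrite Aj gap.
by move=> /(_ _ _ step_ok y).
Qed.

Lemma gap_obstruction : False.
Proof.
have [_ f2 /choice[g gN]] := fN.
(* [g] is a coarse inverse of [f], and [e y] lifts the error from [f (g y)] to [y]. *)
pose e y := lift ((f (g y))^-1 * y)%g.
(* A path [v] from [y] is shadowed by a path [u] from [g y], along which the coordinate in [K] is
   multiplied by [v] up to the coboundary of [e]. *)
have transport v y k : exists2 u, size u <= D * size v &
    run step (g y, k) u =
    (g (y * cls B v), k * e y * cls B' v * (e (y * cls B v))^-1)%g.
  elim: v y k => [|l v IHv] y k.
    by exists [::] => //=; rewrite !cls1 !mulg1 mulgK.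
  set z := (y * cls B [:: l])%g.
  have ballz : ball (1 + N) (cls B [:: l] * ((f (g z))^-1 * z)^-1)%g.
    exact: ballM (ball_cls _ [:: l]) (ballV (gN z)).
  have yz : ((f (g y))^-1 * f (g z) =
      (f (g y))^-1 * y * (cls B [:: l] * ((f (g z))^-1 * z)^-1))%g.
    by rewrite invgM invgK -!mulgA (mulgA y) -/z mulVKg.
  have ballyz : ball (2 * N + 1) ((f (g y))^-1 * f (g z))%g.
    by rewrite yz; apply: ball_le (ballM (gN y) ballz); lia.
  have lift_yz : lift ((f (g y))^-1 * f (g z))%g = (e y * (cls B' [:: l] * (e z)^-1))%g.
    have near M h : M <= 2 * N + 1 -> ball M h -> ball s h.
      by move=> MN; apply: ball_le; apply: leq_trans Ns.
    have gNs x : ball s ((f (g x))^-1 * x)%g by apply: near (gN x); lia.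
    have ls : ball s (cls B [:: l]) by apply: near (ball_cls _ [:: l]) => /=; lia.
    have sz : ball s (cls B [:: l] * ((f (g z))^-1 * z)^-1)%g by apply: near ballz; lia.
    have syz : ball s ((f (g y))^-1 * f (g z))%g by apply: near ballyz.
    rewrite yz liftM -?yz //.
    rewrite liftM //; last exact: ballV.
    by rewrite liftV // liftE //=; move: Ns; lia.
  have [u uD uyz] := f2 (2 * N + 1) (g y) (g z) ballyz.
  have [w wD runw] := IHv z (k * lift ((f (g y))^-1 * f (g z)))%g.
  exists (u ++ w); first by rewrite size_cat mulnS leq_add.
  rewrite run_cat run_short; last first.
    by apply: leq_trans Ds; rewrite leq_add2r leq_mul2l uD orbT.
  rewrite uyz mulVKg runw lift_yz (cls_cons B l v) (cls_cons B' l v) (mulgA y) -/z.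
  by congr (_, _ * _)%g; rewrite -!mulgA mulKg.
(* The shadow of the relator is a loop, which acts trivially by [run_loop], yet it multiplies by a
   conjugate of [cls B' (relator i)], nontrivial as [i] is not in [B']. *)
have [u uD runu] := transport (relator i) 1%g 1%g.
rewrite size_relator in uD.
have rel1 : cls B (relator i) = 1%g by exact: cls_relator.
rewrite rel1 mulg1 mul1g in runu.
have u1 : cls A u = 1%g.
  by apply: (mulgI (g 1%g)); rewrite -(run_fst u _ 1%g) runu mulg1.
have := run_loop (g 1%g, 1%g) uD u1; rewrite runu => -[e1].
have B'i : ~~ B' i by rewrite /B' eqxx andbF.
apply: (relator_neq1 B'i); apply: (mulgI (e 1%g)); apply: (mulIg (e 1%g)^-1%g).
by rewrite e1 mulg1 mulgV.
Qed.

End GapObstruction.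

(* Every bit of [x], as well as its negation, is repeated infinitely often. *)
Definition code (x : nat -> bool) (n : nat) : bool :=
  if @unpickle (bool * nat * nat)%type n is Some (b, k, _) then x k (+) b else false.

Lemma code_neq x y N : x <> y -> exists n, [/\ N <= n, ~~ code x n & code y n].
Proof.
move=> xy; have [k xyk] : exists k, x k != y k.
  apply: contrapT => xyE; apply: xy; apply: funext => k.
  by apply/eqP/negPn/negP => xyk; apply: xyE; exists k.
(* Adding the bit [x k] makes the code false for [x] and true for [y]; injectivity of [p] gives
   positions beyond [N]. *)
pose p (l : nat) : nat := @pickle (bool * nat * nat)%type (x k, k, l).
have p_inj : injective p by move=> l l' /(pcan_inj pickleK) [].
have [l Nl] : exists l, N <= p l.
  apply: contrapT => pN.
  have ltN (l : 'I_N.+1) : p l < N by rewrite ltnNge; apply/negP => Nl; apply: pN; exists l.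
  have /leq_card : injective (fun l : 'I_N.+1 => Ordinal (ltN l)).
    by move=> l l' /(congr1 val) /= /p_inj /val_inj.
  by rewrite !card_ord ltnn.
exists (p l); split=> //; rewrite /code /p pickleK ?addbb //.
by case: (x k) (y k) xyk => [] [].
Qed.

(** * Choice of the windows and conclusion *)

Section Windows.
Variables n m : nat.

Let D : nat := n * (2 * n + 1) + n.
(** The sum of the lower bounds required of [s] in [gap_obstruction], plus [m] to put the site
    beyond radius [m]; [site] exceeds [6 * scale], and [radius] covers the range of [gap]. *)
Definition scale : nat := n * D + n + (2 * n + 1) + (n * (4 * m + 4) + n) + m.
Definition site : nat := 6 * scale + 1.
Definition radius : nat := m + site + 2 * (D * (4 * site + 4)).

Lemma leq_radius : m <= radius. Proof. by rewrite /radius; lia. Qed.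

Lemma window_obstruction A B (f : Gr A -> Gr B) :
  coarse_equiv n f ->
  (forall i : int, m < `|i| <= radius -> ~~ A i) ->
  B site -> False.
Proof.
move=> fn Agap Bsite.
apply: (@gap_obstruction A B f n m scale site) => //; try by rewrite /scale /D; lia.
  by rewrite /site; lia.
move=> j jR Aj; rewrite leqNgt; apply/negP => mj.
suff: ~~ A j by rewrite Aj.
apply: Agap; rewrite mj /=.
by apply: leq_trans jR _; rewrite /radius leq_addl.
Qed.

End Windows.

Theorem corollary1p5 (R : realType) :
  exists G : (nat -> bool) -> groupType,
    [/\ forall i, finitely_generated (G i),
        forall i j, i <> j -> ~ quasi_isometric_groups R (G i) (G j) &
        forall i j, elementarily_equivalent (G i) (G j)].
Proof.
have [E [Edo EP]] := generic_elementarily_equivalent.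
have [m [_ _ mP]] := fusion 0 Edo leq_radius.
(* Each window holds at most its site, present exactly when the code bit is set; the sites do not
   depend on [x]. *)
pose Z x n (i : int) := (i == site n (m n)) && code x n.
have /choice[A AP] : forall x, exists A, (forall n (i : int),
    m n < `|i| <= radius n (m n) -> A i = Z x n i) /\ forall n, E n A.
  by move=> x; have [A [_ AZ EA]] := mP xpred0 (Z x); exists A.
exists (fun x => Gr (A x) : groupType); split.
- by move=> x; exact: Gr_finitely_generated.
- move=> x y xy /quasi_isometric_coarse_equiv[N [f fN]].
  (* As [N <= n], the constant [n] also serves for [f]; in the [n]-th window [A x] is empty while
     [A y] contains the site. *)
  have [n [Nn xn yn]] := code_neq N xy.
  have [[Ax _] [Ay _]] := (AP x, AP y).
  apply: (@window_obstruction n (m n) _ _ f (coarse_equiv_le Nn fN)).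
    by move=> i /Ax ->; rewrite /Z (negbTE xn) andbF.
  rewrite (Ay n) /Z ?eqxx //; apply/andP; split.
    by rewrite /site /scale; lia.
  by rewrite /radius; lia.
- by move=> x y; apply: EP; [case: (AP x) | case: (AP y)].
Qed.
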